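(* Let $\mathcal{G}$ be a groupoid object whose object and morphism spaces are light profinite, and whose source and target maps are open. Then there exist a groupoid $\mathcal{X}$ (again a groupoid object) and a functor $p:\mathcal{X}\to\mathcal{G}$ such that: (i) $\mathrm{Obj}(\mathcal{X})$ and $\mathrm{Mor}(\mathcal{X})$ are light profinite; (ii) the induced map on geometric realizations $|p|:|\mathcal{X}|\to|\mathcal{G}|$ is an equivalence; (iii) $\mathcal{X}$ is skeletal in the sense that for any two distinct objects $x\neq y$ in $\mathrm{Obj}(\mathcal{X})$ one has $\mathrm{Hom}_{\mathcal{X}}(x,y)=\varnothing$.
   Context: A light profinite set is a topological space which is a sequential inverse limit of finite discrete spaces. Groupoid objects are taken in $\mathrm{Pyk}(\mathcal{S})$, the $\infty$-topos of pyknotic spaces (hypercomplete sheaves of spaces on profinite sets for the topology of finite jointly surjective families), in which profinite sets embed fully faithfully. Thus a groupoid object with light profinite object space $\mathrm{Obj}(\mathcal{G})$ and morphism space $\mathrm{Mor}(\mathcal{G})$ is the same as a topological groupoid with these spaces, and a functor is a continuous functor. $|\mathcal{G}|\in\mathrm{Pyk}(\mathcal{S})$ denotes the geometric realization (colimit over $\Delta^{\mathrm{op}}$ of the nerve). *)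

(* Defs.v *)
From HB Require Import structures.
From mathcomp Require Import all_boot all_classical topology function_spaces.

Set Implicit Arguments.
Unset Strict Implicit.
Unset Printing Implicit Defensive.

Local Open Scope classical_set_scope.

Definition homeomorphic (T U : topologicalType) : Prop :=
  exists (f : T -> U) (g : U -> T),
    [/\ continuous f, continuous g, cancel f g & cancel g f].

Definition seq_limit (F : nat -> finType) (t : forall n, F n.+1 -> F n) :
    set (prod_topology (fun n => discrete_topology (F n))) :=
  [set a | forall n, t n (a n.+1) = a n].

Definition light_profinite (T : topologicalType) : Prop :=
  exists (F : nat -> finType) (t : forall n, F n.+1 -> F n),
    homeomorphic T (set_type (seq_limit t)).

Record profinite := Profinite {
  pspace :> topologicalType;
  pspace_compact : compact [set: pspace];
  pspace_hausdorff : hausdorff_space pspace;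
  pspace_tdisc : totally_disconnected [set: pspace] }.

(** The topology of finite jointly surjective families: [locally P] says that
    [P] holds on the members of some covering family of [S]. *)
Definition locally (S : profinite)
    (P : forall T : profinite, continuousType T S -> Prop) : Prop :=
  exists (I : finType) (U : I -> profinite)
         (u : forall i, continuousType (U i) S),
    (forall s : S, exists i (x : U i), u i x = s) /\ forall i, P (U i) (u i).

Record mono (m n : nat) := Mono {
  mono_fun :> 'I_m.+1 -> 'I_n.+1;
  mono_homo : {homo mono_fun : i j / (i <= j)%N} }.

Lemma mono_eq m n (f g : mono m n) : f =1 g -> f = g.
Proof.
case: f g => f hf [g hg] /= /funext e; subst g.
by congr Mono; exact: Prop_irrelevance.
Qed.

Definition mono_id n : mono n n := @Mono n n id (fun _ _ h => h).

Definition mono_comp l m n (g : mono m n) (f : mono l m) : mono l n :=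
  @Mono l n (g \o f) (fun i j h => mono_homo g (mono_homo f h)).

Lemma lift_homo n (j : 'I_n.+2) : {homo lift j : a b / (a <= b)%N}.
Proof. by move=> a b; rewrite /= leq_bump2. Qed.

Definition face n (j : 'I_n.+2) : mono n n.+1 := Mono (@lift_homo n j).

Definition mono_pt m n (k : 'I_n.+1) : mono m n :=
  @Mono m n (fun=> k) (fun _ _ _ => leqnn k).

Record sset := SSet {
  simp :> nat -> Type;
  sact : forall m n, mono m n -> simp n -> simp m;
  sact_id : forall n (x : simp n), sact (mono_id n) x = x;
  sact_comp : forall l m n (g : mono m n) (f : mono l m) (x : simp n),
    sact (mono_comp g f) x = sact f (sact g x) }.

Record smap (K L : sset) := SMap {
  smap_fun :> forall n, K n -> L n;
  smap_nat : forall m n (f : mono m n) (x : K n),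
    smap_fun (sact f x) = sact f (smap_fun x) }.

(** The simplices of the horn [Lambda^n_k]. *)
Definition in_horn n (k : 'I_n.+1) m (f : mono m n) : Prop :=
  exists2 j, j != k & forall i, f i != j.

Lemma in_horn_comp n k l m (g : mono m n) (f : mono l m) :
  in_horn k g -> in_horn k (mono_comp g f).
Proof. by case=> j jk gj; exists j => // i; apply: gj. Qed.

Record horn (K : sset) n (k : 'I_n.+1) := Horn {
  horn_fun :> forall m (f : mono m n), in_horn k f -> K m;
  horn_nat : forall l m (g : mono m n) (f : mono l m) (hg : in_horn k g),
    horn_fun (in_horn_comp f hg) = sact f (horn_fun hg) }.

Definition kan (K : sset) : Prop :=
  forall n (k : 'I_n.+2) (h : horn K k),
    exists x : K n.+1, forall m (f : mono m n.+1) (hf : in_horn k f),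
      sact f x = h m f hf.

Definition connected0 (K : sset) (a b : K 0) : Prop :=
  exists w : K 1, sact (face ord_max) w = a /\ sact (face ord0) w = b.

Definition const_simp (K : sset) (x : K 0) n : K n := sact (mono_pt n ord0) x.

(** Representatives of the elements of [pi_(n+1)(K, x)]. *)
Definition spherical (K : sset) (x : K 0) n (a : K n.+1) : Prop :=
  forall i : 'I_n.+2, sact (face i) a = const_simp x n.

(** Two of them agree in [pi_(n+1)(K, x)] when they are the last two faces of
    an [n+2]-simplex all of whose other faces are constant at [x]; on Kan
    complexes this is an equivalence relation. *)
Definition homotopic (K : sset) (x : K 0) n (a b : K n.+1) : Prop :=
  exists w : K n.+2,
    [/\ sact (face (inord n.+1)) w = a,
        sact (face ord_max) w = b
      & forall i : 'I_n.+3, (i < n.+1)%N ->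
          sact (face i) w = const_simp x n.+1].

Record space_presheaf := SpacePresheaf {
  sec :> profinite -> sset;
  res : forall S T : profinite, continuousType T S -> smap (sec S) (sec T);
  res_id : forall S n (x : sec S n),
    res [the continuousType S S of idfun] n x = x;
  res_comp : forall (S T U : profinite) (u : continuousType T S)
      (v : continuousType U T) n (x : sec S n),
    res [the continuousType U S of u \o v] n x = res v n (res u n x);
  sec_kan : forall S, kan (sec S) }.

Record presheaf_map (F F' : space_presheaf) := PresheafMap {
  pmap_fun :> forall S : profinite, smap (F S) (F' S);
  pmap_nat : forall (S T : profinite) (u : continuousType T S) n (x : F S n),
    pmap_fun T n (res F u n x) = res F' u n (pmap_fun S n x) }.

(** [Pyk(S)] is the localization of presheaves of spaces on profinite sets at
    the maps inducing isomorphisms on all homotopy sheaves, so a map of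
    presheaves becomes an equivalence of pyknotic spaces iff it satisfies
    [pyk_equivalence]. The homotopy sheaves are the sheaves associated with
    [pi_0] and, for each local base point [x] over [S], with the presheaf
    [(u : T -> S) |-> pi_(n+1)(F T, res u x)] on profinite sets over [S]; a map
    of presheaves of sets is an isomorphism after sheafification iff it is
    locally injective and locally surjective. As [S] and [x] are arbitrary, it
    is enough to test elements over [S] itself. *)
Definition pi0_iso (F F' : space_presheaf) (p : presheaf_map F F') : Prop :=
  (forall (S : profinite) (a b : F S 0),
     connected0 (p S 0 a) (p S 0 b) ->
     locally (fun T (u : continuousType T S) =>
       connected0 (res F u 0 a) (res F u 0 b)))
  /\
  (forall (S : profinite) (b : F' S 0),
     locally (fun T (u : continuousType T S) =>
       exists a : F T 0, connected0 (p T 0 a) (res F' u 0 b))).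

Definition pi_iso (F F' : space_presheaf) (p : presheaf_map F F') n : Prop :=
  forall (S : profinite) (x : F S 0),
  (forall a b : F S n.+1, spherical x a -> spherical x b ->
     homotopic (p S 0 x) (p S n.+1 a) (p S n.+1 b) ->
     locally (fun T (u : continuousType T S) =>
       homotopic (res F u 0 x) (res F u n.+1 a) (res F u n.+1 b)))
  /\
  (forall b : F' S n.+1, spherical (p S 0 x) b ->
     locally (fun T (u : continuousType T S) =>
       exists a : F T n.+1, spherical (res F u 0 x) a /\
         homotopic (p T 0 (res F u 0 x)) (p T n.+1 a) (res F' u n.+1 b))).

Definition pyk_equivalence (F F' : space_presheaf) (p : presheaf_map F F') :
  Prop := pi0_iso p /\ forall n, pi_iso p n.

(** [comp g f] is [g] after [f]; it is a total function whose values matter only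
    when [src g = tgt f]. *)
Record groupoid_laws (Obj Mor : Type) (src tgt : Mor -> Obj) (idm : Obj -> Mor)
    (inv : Mor -> Mor) (comp : Mor -> Mor -> Mor) : Prop := GroupoidLaws {
  src_idm : forall x, src (idm x) = x;
  tgt_idm : forall x, tgt (idm x) = x;
  src_inv : forall f, src (inv f) = tgt f;
  tgt_inv : forall f, tgt (inv f) = src f;
  src_comp : forall g f, src g = tgt f -> src (comp g f) = src f;
  tgt_comp : forall g f, src g = tgt f -> tgt (comp g f) = tgt g;
  compA : forall h g f, src h = tgt g -> src g = tgt f ->
    comp h (comp g f) = comp (comp h g) f;
  comp_idl : forall f, comp (idm (tgt f)) f = f;
  comp_idr : forall f, comp f (idm (src f)) = f;
  comp_invl : forall f, comp (inv f) f = idm (src f);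
  comp_invr : forall f, comp f (inv f) = idm (tgt f) }.

Record groupoid := Groupoid {
  gObj : Type;
  gMor : Type;
  gsrc : gMor -> gObj;
  gtgt : gMor -> gObj;
  gid : gObj -> gMor;
  ginv : gMor -> gMor;
  gcomp : gMor -> gMor -> gMor;
  glaws : groupoid_laws gsrc gtgt gid ginv gcomp }.

Record gfunctor (X Y : groupoid) := GFunctor {
  gfobj : gObj X -> gObj Y;
  gfmor : gMor X -> gMor Y;
  gfsrc : forall f, gsrc (gfmor f) = gfobj (gsrc f);
  gftgt : forall f, gtgt (gfmor f) = gfobj (gtgt f);
  gfid : forall x, gfmor (gid x) = gid (gfobj x);
  gfcomp : forall g f, gsrc g = gtgt f ->
    gfmor (gcomp g f) = gcomp (gfmor g) (gfmor f) }.

Record tgroupoid := TGroupoid {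
  Obj : topologicalType;
  Mor : topologicalType;
  src : Mor -> Obj;
  tgt : Mor -> Obj;
  idm : Obj -> Mor;
  invm : Mor -> Mor;
  compm : Mor -> Mor -> Mor;
  tlaws : groupoid_laws src tgt idm invm compm;
  src_cts : continuous src;
  tgt_cts : continuous tgt;
  idm_cts : continuous idm;
  invm_cts : continuous invm;
  compm_cts : {within [set gf : Mor * Mor | src gf.1 = tgt gf.2],
                continuous (fun gf => compm gf.1 gf.2)} }.

Record tfunctor (X Y : tgroupoid) := TFunctor {
  fobj : Obj X -> Obj Y;
  fmor : Mor X -> Mor Y;
  fobj_cts : continuous fobj;
  fmor_cts : continuous fmor;
  fsrc : forall f, src (fmor f) = fobj (src f);
  ftgt : forall f, tgt (fmor f) = fobj (tgt f);
  fid : forall x, fmor (idm x) = idm (fobj x);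
  fcomp : forall g f, src g = tgt f -> fmor (compm g f) = compm (fmor g) (fmor f) }.

Definition open_map (T U : topologicalType) (f : T -> U) : Prop :=
  forall A : set T, open A -> open (f @` A).

(** A functor from the ordered set [0 <= ... <= n]. *)
Record nsimp (G : groupoid) n := NSimp {
  vert : 'I_n.+1 -> gObj G;
  edge : forall i j : 'I_n.+1, (i <= j)%N -> gMor G;
  edge_src : forall (i j : 'I_n.+1) (ij : (i <= j)%N), gsrc (edge ij) = vert i;
  edge_tgt : forall (i j : 'I_n.+1) (ij : (i <= j)%N), gtgt (edge ij) = vert j;
  edge_id : forall (i : 'I_n.+1) (ii : (i <= i)%N), edge ii = gid (vert i);
  edge_comp : forall (i j k : 'I_n.+1)
      (ij : (i <= j)%N) (jk : (j <= k)%N) (ik : (i <= k)%N),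
    edge ik = gcomp (edge jk) (edge ij) }.

Lemma nsimp_eq (G : groupoid) n (a b : nsimp G n) : vert a =1 vert b ->
  (forall (i j : 'I_n.+1) (ij : (i <= j)%N), edge a ij = edge b ij) -> a = b.
Proof.
case: a b => [v e s t d c] [v' e' s' t' d' c'] /= /funext vv ee; subst v'.
have {}ee : e = e' by do 3 (apply: functional_extensionality_dep => ?).
by subst e'; congr NSimp; exact: Prop_irrelevance.
Qed.

Definition nerve_act (G : groupoid) m n (f : mono m n) (x : nsimp G n) :
    nsimp G m :=
  @NSimp G m (vert x \o f) (fun i j ij => edge x (mono_homo f ij))
    (fun _ _ _ => edge_src _ _) (fun _ _ _ => edge_tgt _ _)
    (fun _ _ => edge_id _ _) (fun _ _ _ _ _ _ => edge_comp _ _ _ _).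

Lemma edge_irr (G : groupoid) n (x : nsimp G n) (i j i' j' : 'I_n.+1)
    (ij : (i <= j)%N) (ij' : (i' <= j')%N) :
  i = i' -> j = j' -> edge x ij = edge x ij'.
Proof. by move=> ei ej; subst i' j'; congr edge; exact: Prop_irrelevance. Qed.

Lemma nerve_act_id (G : groupoid) n (x : nsimp G n) :
  nerve_act (mono_id n) x = x.
Proof. by apply: nsimp_eq => //= i j ij; exact: edge_irr. Qed.

Lemma nerve_act_comp (G : groupoid) l m n (g : mono m n) (f : mono l m)
  (x : nsimp G n) : nerve_act (mono_comp g f) x = nerve_act f (nerve_act g x).
Proof. by apply: nsimp_eq => //= i j ij; exact: edge_irr. Qed.

Definition nerve (G : groupoid) : sset :=
  SSet (@nerve_act_id G) (@nerve_act_comp G).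

Section NerveMap.
Variables (X Y : groupoid) (p : gfunctor X Y) (n : nat) (x : nsimp X n).
Let e (i j : 'I_n.+1) (ij : (i <= j)%N) := gfmor p (edge x ij).

Lemma nmap_src (i j : 'I_n.+1) (ij : (i <= j)%N) :
  gsrc (e ij) = gfobj p (vert x i).
Proof. by rewrite gfsrc edge_src. Qed.

Lemma nmap_tgt (i j : 'I_n.+1) (ij : (i <= j)%N) :
  gtgt (e ij) = gfobj p (vert x j).
Proof. by rewrite gftgt edge_tgt. Qed.

Lemma nmap_id (i : 'I_n.+1) (ii : (i <= i)%N) :
  e ii = gid (gfobj p (vert x i)).
Proof. by rewrite /e edge_id gfid. Qed.

Lemma nmap_comp (i j k : 'I_n.+1)
    (ij : (i <= j)%N) (jk : (j <= k)%N) (ik : (i <= k)%N) :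
  e ik = gcomp (e jk) (e ij).
Proof.
by rewrite /e (edge_comp x ij jk) gfcomp // edge_src edge_tgt.
Qed.

Definition nmap : nsimp Y n := NSimp nmap_src nmap_tgt nmap_id nmap_comp.
End NerveMap.

Lemma nmap_nat (X Y : groupoid) (p : gfunctor X Y) m n (f : mono m n)
  (x : nerve X n) : nmap p (sact f x) = sact f (nmap p x : nerve Y n).
Proof. exact: nsimp_eq. Qed.

Definition nerve_map (X Y : groupoid) (p : gfunctor X Y) :
  smap (nerve X) (nerve Y) := 
  @SMap (nerve X) (nerve Y) (@nmap X Y p) (@nmap_nat X Y p).

Section Ext.
Variable G : groupoid.
Local Notation L := (glaws G).
Implicit Types f g : gMor G.

(** [ext a i j] is the morphism of the functor [a] from vertex [i] to [j],
   whatever their order. *)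
Definition ext n (a : nerve G n) (i j : 'I_n.+1) : gMor G :=
  gcomp (edge a (leq0n j : (@ord0 n <= j)%N)) (ginv (edge a (leq0n i : (@ord0 n <= i)%N))).

Lemma ext_cond n (a : nerve G n) (i j : 'I_n.+1) :
  gsrc (edge a (leq0n j : (@ord0 n <= j)%N)) = gtgt (ginv (edge a (leq0n i : (@ord0 n <= i)%N))).
Proof. by rewrite (tgt_inv L) !edge_src. Qed.

Lemma ext_src n (a : nerve G n) i j : gsrc (ext a i j) = vert a i.
Proof.
rewrite /ext (src_comp L); first by rewrite (src_inv L) edge_tgt.
exact: ext_cond.
Qed.

Lemma ext_tgt n (a : nerve G n) i j : gtgt (ext a i j) = vert a j.
Proof. by rewrite /ext (tgt_comp L) ?edge_tgt //; exact: ext_cond. Qed.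

Lemma comp_cancel f g e : gsrc f = gtgt e -> gsrc g = gtgt e ->
  gcomp (gcomp g e) (ginv (gcomp f e)) = gcomp g (ginv f).
Proof.
move=> fe ge.
have c1 : gsrc (gcomp g e) = gtgt (ginv (gcomp f e)).
  by rewrite (src_comp L) // (tgt_inv L) (src_comp L).
set h := ginv (gcomp f e).
have hs : gsrc h = gtgt f by rewrite (src_inv L) (tgt_comp L).
have ht : gtgt h = gsrc e by rewrite (tgt_inv L) (src_comp L).
have ehs : gsrc e = gtgt h by [].
have et : gtgt (gcomp e h) = gsrc f by rewrite (tgt_comp L).
have eh : gcomp e h = ginv f.
  have cs : gsrc (ginv f) = gtgt f by rewrite (src_inv L).
  have idf : gcomp (gcomp f e) h = gid (gtgt f).
    by rewrite (comp_invr L) (tgt_comp L).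
  have -> : gcomp e h = gcomp (gcomp (ginv f) f) (gcomp e h).
    by rewrite (comp_invl L) -et (comp_idl L).
  rewrite -(compA L cs (esym et)) (compA L fe ehs) idf.
  by rewrite -cs (comp_idr L).
by rewrite -(compA L) // eh.
Qed.

Lemma comp_chain f g h : gsrc f = gsrc g -> gsrc g = gsrc h ->
  gcomp (gcomp h (ginv g)) (gcomp g (ginv f)) = gcomp h (ginv f).
Proof.
move=> fg gh.
have c1 : gsrc h = gtgt (ginv g) by rewrite (tgt_inv L).
have c2 : gsrc g = gtgt (ginv f) by rewrite (tgt_inv L).
have c3 : gsrc (ginv g) = gtgt (gcomp g (ginv f)).
  by rewrite (src_inv L) (tgt_comp L).
rewrite -(compA L c1 c3) (compA L (src_inv L g) c2).
by rewrite (comp_invl L) c2 (comp_idl L).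
Qed.

Lemma ext_chain n (a : nerve G n) i j k :
  gcomp (ext a j k) (ext a i j) = ext a i k.
Proof. by rewrite /ext comp_chain ?edge_src. Qed.

Lemma ext_ii n (a : nerve G n) i : ext a i i = gid (vert a i).
Proof. by rewrite /ext (comp_invr L) edge_tgt. Qed.

Lemma ext_edge n (a : nerve G n) (i j : 'I_n.+1) (ij : (i <= j)%N) : ext a i j = edge a ij.
Proof.
rewrite /ext (edge_comp a (leq0n i : (@ord0 n <= i)%N) ij).
have c : gsrc (edge a ij) = gtgt (edge a (leq0n i : (@ord0 n <= i)%N)) by rewrite edge_src edge_tgt.
have c' := esym (tgt_inv L (edge a (leq0n i : (@ord0 n <= i)%N))).
by rewrite -(compA L c c') (comp_invr L) -c (comp_idr L).
Qed.

Lemma ext_act m n (f : mono m n) (a : nerve G n) i j :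
  ext (sact f a) i j = ext a (f i) (f j).
Proof.
rewrite /ext /=.
have H (k : 'I_m.+1) : edge a (mono_homo f (leq0n k : (@ord0 m <= k)%N)) = ext a (f ord0) (f k).
  by rewrite (ext_edge a (mono_homo f (leq0n k : (@ord0 m <= k)%N))).
rewrite !H /ext comp_cancel // (tgt_inv L) !edge_src //.
Qed.

End Ext.

Section NerveKan.
Variables (G : groupoid) (n : nat) (k : 'I_n.+2) (h : horn (nerve G) k).
Local Notation L := (glaws G).

Lemma horn_irr m (f g : mono m n.+1) (hf : in_horn k f) (hg : in_horn k g) :
  f = g -> h _ _ hf = h _ _ hg.
Proof. by move=> e; subst g; congr (h m f _); exact: Prop_irrelevance. Qed.

Lemma face_in_horn (j : 'I_n.+2) : j != k -> in_horn k (face j).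
Proof. by move=> jk; exists j => // i; rewrite eq_sym neq_lift. Qed.

Lemma face_factor m (f : mono m n.+1) (j : 'I_n.+2) :
  (forall i, f i != j) -> {f' : mono m n | f = mono_comp (face j) f'}.
Proof.
move=> fj.
have fl i : {a : 'I_n.+1 | lift j a = f i}.
  by have /unlift_some[a ea _] : j != f i by [rewrite eq_sym]; exists a.
have hom : {homo (fun i => sval (fl i)) : a b / (a <= b)%N}.
  move=> a b ab; have := mono_homo f ab.
  by case: (fl a) (fl b) => [a' /= <-] [b' /= <-]; rewrite /= leq_bump2.
exists (Mono hom); apply: mono_eq => i /=; exact/esym/(svalP (fl i)).
Qed.

Lemma horn_factor m (f : mono m n.+1) (hf : in_horn k f) (j : 'I_n.+2)
    (jk : j != k) (f' : mono m n) : f = mono_comp (face j) f' ->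
  h _ _ hf = sact f' (h _ _ (face_in_horn jk)).
Proof.
move=> e; rewrite -(horn_nat h f' (face_in_horn jk)); exact: horn_irr.
Qed.

Definition mk_fun (a : 'I_n.+2) (i : 'I_2) : 'I_n.+2 :=
  if (k <= a)%N == (i == ord0) then k else a.

Lemma mk_homo a : {homo mk_fun a : i j / (i <= j)%N}.
Proof.
move=> [[|[]] // hi] [[|[]] // hj] //= _; rewrite /mk_fun -!val_eqE /= ?leqnn //.
by case: (leqP k a) => //= /ltnW.
Qed.

Definition mk a : mono 1 n.+1 := Mono (@mk_homo a).
Definition pk (a : 'I_n.+2) : 'I_2 := if (k <= a)%N then ord0 else ord_max.
Definition pa (a : 'I_n.+2) : 'I_2 := if (k <= a)%N then ord_max else ord0.

Lemma mk_pk a : mk a (pk a) = k.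
Proof. by rewrite /= /mk_fun /pk; case: (leqP k a). Qed.

Lemma mk_pa a : mk a (pa a) = a.
Proof. by rewrite /= /mk_fun /pa; case: (leqP k a). Qed.

Lemma mk_or a i : mk a i = k \/ mk a i = a.
Proof. by rewrite /= /mk_fun; case: ifP; [left | right]. Qed.

Section Pos.
Hypothesis n_gt0 : (0 < n)%N.

Lemma mk_in_horn a : in_horn k (mk a).
Proof.
have [j /andP[jk ja]] : exists j : 'I_n.+2, (j != k) && (j != a).
  apply/existsP; rewrite -[X in is_true X]negbK negb_exists; apply/negP => /forallP H.
  have : ('I_n.+2 : predArgType) \subset [set k; a]%SET.
    by apply/fintype.subsetP => j _; have := H j; rewrite !inE negb_and !negbK.
  move/subset_leq_card; rewrite card_ord cards2.
  by case: (k != a) n_gt0; case: (n).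
by exists j => // i; case: (mk_or a i) => ->; rewrite eq_sym.
Qed.

Definition gk a := ext (h _ _ (mk_in_horn a)) (pk a) (pa a).

Lemma gkE (j : 'I_n.+2) (jk : j != k) k' a' : lift j k' = k ->
  gk (lift j a') = ext (h _ _ (face_in_horn jk)) k' a'.
Proof.
move=> ek; rewrite /gk; set a := lift j a'.
have mj i : mk a i != j.
  case: (mk_or a i) => ->; first by rewrite eq_sym.
  by rewrite eq_sym neq_lift.
have [f' ef] := face_factor mj.
have ev i : mk a i = lift j (f' i) by rewrite ef.
rewrite (horn_factor _ jk ef) ext_act; congr ext.
  by apply: (@lift_inj _ j); rewrite -ev mk_pk.
by apply: (@lift_inj _ j); rewrite -ev mk_pa.
Qed.

Definition hpt : in_horn k (mono_pt 0 k).
Proof.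
exists (lift k ord0); first by rewrite eq_sym neq_lift.
by move=> i; rewrite /= neq_lift.
Qed.

Lemma gk_src a : gsrc (gk a) = vert (h _ _ hpt) ord0.
Proof.
rewrite /gk ext_src.
have e : mono_pt 0 k = mono_comp (mk a) (mono_pt 0 (pk a)).
  by apply: mono_eq => i /=; rewrite -[mk_fun _ _]/(mk a _) mk_pk.
by rewrite (horn_irr _ (in_horn_comp _ (mk_in_horn a)) e) horn_nat.
Qed.

Let fe (i j : 'I_n.+2) (_ : (i <= j)%N) := gcomp (gk j) (ginv (gk i)).

Let cond i j : gsrc (gk j) = gtgt (ginv (gk i)).
Proof. by rewrite (tgt_inv L) !gk_src. Qed.

Let fe_src (i j : 'I_n.+2) (ij : (i <= j)%N) : gsrc (@fe i j ij) = gtgt (gk i).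
Proof. by rewrite (src_comp L) // (src_inv L). Qed.

Let fe_tgt (i j : 'I_n.+2) (ij : (i <= j)%N) : gtgt (@fe i j ij) = gtgt (gk j).
Proof. by rewrite (tgt_comp L). Qed.

Let fe_id (i : 'I_n.+2) (ii : (i <= i)%N) : @fe i i ii = gid (gtgt (gk i)).
Proof. by rewrite /fe (comp_invr L). Qed.

Let fe_comp (i j l : 'I_n.+2) (ij : (i <= j)%N) (jl : (j <= l)%N) (il : (i <= l)%N) :
  @fe i l il = gcomp (@fe j l jl) (@fe i j ij).
Proof. by rewrite /fe comp_chain ?gk_src. Qed.

Definition filler : nerve G n.+1 :=
  @NSimp G n.+1 (fun i => gtgt (gk i)) (@fe) fe_src fe_tgt fe_id fe_comp.

Lemma fillerP m (f : mono m n.+1) (hf : in_horn k f) : sact f filler = h _ _ hf.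
Proof.
have [j jk fj] := hf.
have [f' ef] := face_factor fj.
have [k' ek _] := unlift_some jk.
rewrite (horn_factor _ jk ef).
have fv i : f i = lift j (f' i) by rewrite ef.
have gf i : gk (f i) = ext (h _ _ (face_in_horn jk)) k' (f' i).
  by rewrite fv; apply: gkE (esym ek).
apply: nsimp_eq => [i|a b ab] /=; first by rewrite gf ext_tgt.
rewrite /fe !gf /ext comp_cancel ?edge_src //; last by rewrite (tgt_inv L) edge_src.
  by rewrite -/(ext _ _ _) (ext_edge _ (mono_homo f' ab)).
by rewrite (tgt_inv L) edge_src.
Qed.
End Pos.

End NerveKan.

Lemma nerve_kan (G : groupoid) : kan (nerve G).
Proof.
move=> [|n] k h; last by exists (filler h (ltn0Sn n)) => m f hf; exact: fillerP.
exists (sact (mono_pt 1 ord0) (h _ _ (hpt k))) => m f hf.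
have -> : h m f hf = sact (mono_pt m ord0) (h _ _ (hpt k)).
  rewrite -horn_nat; apply: horn_irr; apply: mono_eq => i /=.
  have ord2 (a b c : 'I_2) : c != b -> a != c -> a = b.
    by case: a b c => [[|[|//]] ?] [[|[|//]] ?] [[|[|//]] ?] // _ _; exact: val_inj.
  by case: hf => j jk fj; exact: ord2 jk (fj i).
by rewrite -!sact_comp; congr sact; apply: mono_eq.
Qed.

(** The groupoid of [S]-points, [S |-> C(S, G)]. The value of [compm] on
    non-composable pairs need not be continuous, whence the case distinction;
    see [pcompE]. *)
Section Points.
Variables (G : tgroupoid) (S : profinite).
Local Notation L := (tlaws G).
Local Notation O := (continuousType S (Obj G)).
Local Notation M := (continuousType S (Mor G)).

Definition cts (T : topologicalType) (f : S -> T) (cf : continuous f) :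
  continuousType S T := [the continuousType S T of mkcts cf].

Lemma cts_postcomp (T U : topologicalType) (f : continuousType S T)
  (g : T -> U) : continuous g -> continuous (g \o f).
Proof. by move=> cg x; apply: continuous_comp; [exact: cts_fun | exact: cg]. Qed.

Lemma compm_cts_points (g f : M) : (forall s, src (g s) = tgt (f s)) ->
  continuous (fun s => compm (g s) (f s)).
Proof.
move=> gf s A nA.
have := @compm_cts G (g s, f s) A nA.
rewrite /nbhs /= /nbhs_subspace /=.
case: ifPn => [_|]; last by rewrite notin_setE /= => /(_ (gf s)).
move=> [[P Q] /= [nP nQ] PQ].
have nP' : nbhs s (g @^-1` P) by apply: cts_fun.
have nQ' : nbhs s (f @^-1` Q) by apply: cts_fun.
apply: filterS2 nP' nQ' => t Pt Qt.
by apply: (PQ (g t, f t)) => /=; [split | exact: gf].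
Qed.

Definition psrc (f : M) : O := cts (@cts_postcomp _ _ f _ (@src_cts G)).
Definition ptgt (f : M) : O := cts (@cts_postcomp _ _ f _ (@tgt_cts G)).
Definition pid (x : O) : M := cts (@cts_postcomp _ _ x _ (@idm_cts G)).
Definition pinv (f : M) : M := cts (@cts_postcomp _ _ f _ (@invm_cts G)).
Definition pcomp (g f : M) : M :=
  match pselect (continuous (fun s => compm (g s) (f s))) with
  | left c => cts c
  | right _ => f
  end.

Lemma pcompE (g f : M) : psrc g = ptgt f ->
  forall s, pcomp g f s = compm (g s) (f s).
Proof.
move=> /continuousEP gf s; rewrite /pcomp; case: pselect => // nc.
by case: nc; apply: compm_cts_points.
Qed.

Lemma points_laws : groupoid_laws psrc ptgt pid pinv pcomp.
Proof.
have E (g f : M) (e : psrc g = ptgt f) : pcomp g f = (fun s => compm (g s) (f s)) :> (S -> Mor G).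
  exact: funext (pcompE e).
have P (f g : M) : psrc g = ptgt f -> forall s, src (g s) = tgt (f s).
  by move=> /continuousEP.
have Esrc g f : psrc g = ptgt f -> psrc (pcomp g f) = psrc f.
  move=> e; apply/continuousEP => s /=; rewrite /mkcts /= E //.
  by rewrite (src_comp L) //; exact: P.
have Etgt g f : psrc g = ptgt f -> ptgt (pcomp g f) = ptgt g.
  move=> e; apply/continuousEP => s /=; rewrite /mkcts /= E //.
  by rewrite (tgt_comp L) //; exact: P.
split=> //.
- by move=> x; apply/continuousEP => s; exact: (src_idm L).
- by move=> x; apply/continuousEP => s; exact: (tgt_idm L).
- by move=> f; apply/continuousEP => s; exact: (src_inv L).
- by move=> f; apply/continuousEP => s; exact: (tgt_inv L).
- move=> h g f hg gf; apply/continuousEP => s.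
  rewrite !E ?Etgt ?Esrc //; apply: (compA L); exact: P.
- move=> f; apply/continuousEP => s; rewrite E; last first.
    by apply/continuousEP => x; exact: (src_idm L).
  exact: (comp_idl L).
- move=> f; apply/continuousEP => s; rewrite E; last first.
    by apply/continuousEP => x; apply/esym; exact: (tgt_idm L).
  exact: (comp_idr L).
- move=> f; apply/continuousEP => s; rewrite E; last first.
    by apply/continuousEP => x; exact: (src_inv L).
  exact: (comp_invl L).
- move=> f; apply/continuousEP => s; rewrite E; last first.
    by apply/continuousEP => x; apply/esym; exact: (tgt_inv L).
  exact: (comp_invr L).
Qed.

Definition points : groupoid := Groupoid points_laws.
End Points.

Lemma points_res_comp (G : tgroupoid) (S T : profinite)
    (u : continuousType T S) (g f : gMor (points G S)) : gsrc g = gtgt f ->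
  [the continuousType T (Mor G) of gcomp g f \o u] =
  gcomp ([the continuousType T (Mor G) of g \o u] : gMor (points G T))
        [the continuousType T (Mor G) of f \o u].
Proof.
move=> e; have e' s : src (g s) = tgt (f s) by move/continuousEP: e => /(_ s).
apply/continuousEP => t /=; rewrite [LHS]pcompE // [RHS]pcompE //.
by apply/continuousEP => x; exact: e'.
Qed.

Definition points_res (G : tgroupoid) (S T : profinite)
    (u : continuousType T S) : gfunctor (points G S) (points G T).
Proof.
apply: (@GFunctor (points G S) (points G T)
    (fun x => [the continuousType T (Obj G) of x \o u])
    (fun f => [the continuousType T (Mor G) of f \o u])).
- by move=> f; apply/continuousEP.
- by move=> f; apply/continuousEP.
- by move=> x; apply/continuousEP.
- exact: points_res_comp.
Defined.

Lemma realization_id (G : tgroupoid) (S : profinite) n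
    (x : nerve (points G S) n) :
  nerve_map (points_res G [the continuousType S S of idfun]) n x = x.
Proof. by apply: nsimp_eq => [i|i j ij]; apply/continuousEP. Qed.

Lemma realization_comp (G : tgroupoid) (S T U : profinite)
    (u : continuousType T S) (v : continuousType U T) n
    (x : nerve (points G S) n) :
  nerve_map (points_res G [the continuousType U S of u \o v]) n x =
  nerve_map (points_res G v) n (nerve_map (points_res G u) n x).
Proof. by apply: nsimp_eq => [i|i j ij]; apply/continuousEP. Qed.

(** The presheaf of spaces presenting [|G|]. The space [N_m G] of the nerve
    is a finite limit of copies of [Obj G] and [Mor G], so
    [C(S, N_m G) = N_m (points G S)]; the colimit over [Delta^op], computed in
    presheaves of spaces, of the discrete presheaves [N_m G] is then the
    presheaf of simplicial sets [S |-> N (points G S)], and [|G|] is the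
    hypercomplete sheaf associated with it. *)
Definition realization (G : tgroupoid) : space_presheaf :=
  @SpacePresheaf (fun S => nerve (points G S))
    (fun S T u => nerve_map (points_res G u))
    (@realization_id G) (@realization_comp G) (fun S => @nerve_kan (points G S)).

Section RealizationMap.
Variables (X G : tgroupoid) (p : tfunctor X G).

Definition pfobj (S : profinite) (x : gObj (points X S)) : gObj (points G S) :=
  cts (@cts_postcomp S _ _ x _ (@fobj_cts _ _ p)).
Definition pfmor (S : profinite) (f : gMor (points X S)) : gMor (points G S) :=
  cts (@cts_postcomp S _ _ f _ (@fmor_cts _ _ p)).

Lemma pfsrc S f : gsrc (@pfmor S f) = pfobj (gsrc f).
Proof. by apply/continuousEP => s; exact: fsrc. Qed.

Lemma pftgt S f : gtgt (@pfmor S f) = pfobj (gtgt f).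
Proof. by apply/continuousEP => s; exact: ftgt. Qed.

Lemma pfid S x : @pfmor S (gid x) = gid (pfobj x).
Proof. by apply/continuousEP => s; exact: fid. Qed.

Lemma pfcomp S (g f : gMor (points X S)) : gsrc g = gtgt f ->
  pfmor (gcomp g f) = gcomp (pfmor g) (pfmor f).
Proof.
move=> e; have e' s : src (g s) = tgt (f s) by move/continuousEP: e => /(_ s).
apply/continuousEP => s; rewrite [RHS]pcompE.
  by rewrite -[LHS]/(fmor p (pcomp g f s)) pcompE // fcomp.
by apply/continuousEP => x /=; rewrite /mkcts /= fsrc ftgt e'.
Qed.

Definition points_map S : gfunctor (points X S) (points G S) :=
  GFunctor (@pfsrc S) (@pftgt S) (@pfid S) (@pfcomp S).

Lemma realization_map_nat (S T : profinite) (u : continuousType T S) n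
    (x : realization X S n) :
  nerve_map (points_map T) n (res (realization X) u n x) =
  res (realization G) u n (nerve_map (points_map S) n x).
Proof. by apply: nsimp_eq => [i|i j ij]; apply/continuousEP. Qed.

Definition realization_map : presheaf_map (realization X) (realization G) :=
  @PresheafMap (realization X) (realization G)
    (fun S => nerve_map (points_map S)) realization_map_nat.
End RealizationMap.

(* Main.v *)
Require Import Defs.
From mathcomp Require Import all_boot all_classical topology function_spaces.

Set Implicit Arguments.
Unset Strict Implicit.
Unset Printing Implicit Defensive.

Local Open Scope classical_set_scope.

(** The groupoid [X] is the full subgroupoid of [G] on a closed set [E] of
    objects that meets every isomorphism class in exactly one point.

    To find [E], fix clopen sets [U 0, U 1, ...] separating the points of
    [Obj G] and thin out [Obj G] step by step ([sieve]): at step [n], in every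
    isomorphism class that still has a point in [U n], discard the points
    outside [U n]. The union of the classes that still have a point in [U n] is the
    saturation [tgt (src^-1 A)] of a clopen set [A]. It is closed because
    [Mor G] is compact and open because [tgt] is open, so every stage is clopen.
    No stage empties a class, so by compactness the intersection [E] of all
    stages meets every class; two points of a class that survive every step are
    separated by no [U n], hence equal. Closed subspaces of light profinite
    spaces are light profinite, and [X] is skeletal by construction.

    For the equivalence, the inclusion of [S]-points of [X] into [S]-points of
    [G] is fully faithful and injective on objects, so a simplex of the nerve of
    [points G S] all of whose vertices lie in [points X S] comes from a unique
    simplex of the nerve of [points X S]. This gives injectivity on [pi_0] and
    bijectivity on all [pi_(n+1)] already over [S] itself ([embedding_pi]). Only
    surjectivity on [pi_0] needs a cover: given [x : S -> Obj G], the pairs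
    [(s, f)] where [f] goes from [x s] to a point of [E] form a profinite set
    that surjects onto [S], and over it the tautological [f] joins [x] to a
    point of [X] ([points_surjective]). *)

(** * Subspaces, products and compactness *)

Lemma continuous_into_subtype (T U : topologicalType) (A : set U)
    (f : T -> set_type A) :
  continuous (fun t => \val (f t)) -> continuous f.
Proof. exact: continuous_comp_initial. Qed.

Lemma continuous_val (U : topologicalType) (A : set U) :
  continuous (fun a : set_type A => \val a : U).
Proof. exact: initial_continuous. Qed.

Lemma continuous_compose (T U V : topologicalType) (f : T -> U) (g : U -> V) :
  continuous f -> continuous g -> continuous (g \o f).
Proof. by move=> cf cg x; apply: continuous_comp; [exact: cf|exact: cg]. Qed.

Lemma continuous_pair (T U V : topologicalType) (f : T -> U) (g : T -> V) :
  continuous f -> continuous g -> continuous (fun t => (f t, g t)).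
Proof. by move=> cf cg t; apply: cvg_pair; [exact: cf|exact: cg]. Qed.

Lemma continuous_coord (T : topologicalType) (I : eqType)
    (K : I -> topologicalType) (f : T -> prod_topology K) :
  (forall i, continuous (fun t => f t i)) -> continuous f.
Proof.
move=> cf t; apply/cvg_sup => i.
apply: (@continuous_comp_initial _ _ _ (fun g : forall i, K i => g i) f).
exact: cf.
Qed.

Lemma compact_subtype (T : topologicalType) (A : set T) :
  compact [set: T] -> closed A -> compact [set: set_type A].
Proof.
move=> cT clA F PF _.
have cA : compact A by exact: (subclosed_compact clA cT (@subsetT _ _)).
pose G := (fun a : set_type A => \val a : T) @ F.
have GA : G A.
  rewrite /G /= nbhs_simpl; apply: filterS (@filterT _ F _) => a _.
  exact: set_valP a.
have [p [Ap clp]] := cA G _ GA.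
(* The neighbourhoods of [p] in [A] are traces of neighbourhoods in [T], so [p]
   is also a cluster point of [F]. *)
exists (SigSub (mem_set Ap)); split => // B C FB [_ [[W oW <-]] /= Wp WC].
have [||t [[a Ba <-] Wa]] := clp ((fun a : set_type A => \val a : T) @` B) W.
- rewrite /G /= nbhs_simpl.
  by apply: filterS FB => a Ba; exists a.
- exact: open_nbhs_nbhs.
- by exists a; split => //; exact: WC.
Qed.

Lemma compact_nested (T : topologicalType) (C : nat -> set T) :
  compact [set: T] -> (forall n, closed (C n)) ->
  (forall n, C n.+1 `<=` C n) -> (forall n, C n !=set0) ->
  \bigcap_n C n !=set0.
Proof.
move=> cT clC dC neC.
have dC' m n : (m <= n)%N -> C n `<=` C m.
  elim: n => [|n IH]; first by rewrite leqn0 => /eqP ->.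
  rewrite leq_eqVlt => /predU1P[-> //|mn].
  exact: subset_trans (dC n) (IH mn).
have FF : ProperFilter (filter_from [set: nat] C).
  apply: filter_from_proper => //; apply: filter_from_filter; first by exists 0%N.
  move=> m n _ _; exists (maxn m n) => // x Cx.
  by split; [exact: dC' (leq_maxl m n) _ Cx|exact: dC' (leq_maxr m n) _ Cx].
have [|p [_ clp]] := cT _ FF; first exact: filterT.
exists p => n _; apply: clC => B nB.
have := clp (C n) B; rewrite /filter_from /=; apply => //.
by exists n.
Qed.

Lemma zero_dimensional_hausdorff (T : topologicalType) :
  zero_dimensional T -> hausdorff_space T.
Proof.
move=> zd x y cxy; apply: contrapT => /eqP/zd[U [[oU cU] Ux Uy]].
have [||z [] //] := cxy U (~` U).
  exact: open_nbhs_nbhs.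
by apply: open_nbhs_nbhs; split => //; exact: closed_openC.
Qed.

Lemma closed_equalizer (T U : topologicalType) (f g : T -> U) :
  hausdorff_space U -> continuous f -> continuous g ->
  closed [set x | f x = g x].
Proof.
move=> hU cf cg x clx; apply: hU => A B nA nB.
have nfA : nbhs x (f @^-1` A) by exact: cf.
have ngB : nbhs x (g @^-1` B) by exact: cg.
have [y [/= fgy [Ay By]]] := clx _ (filterI nfA ngB).
by exists (f y); split => //; rewrite fgy.
Qed.

Lemma bijective_homeomorphic (T U : topologicalType) (f : T -> U) :
  compact [set: T] -> hausdorff_space U -> continuous f -> injective f ->
  (forall u, exists t, f t = u) -> homeomorphic T U.
Proof.
move=> cT hU cf fI fS; pose g u := sval (cid (fS u)).
have fg : cancel g f by move=> u; exact: svalP (cid (fS u)).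
have gf : cancel f g by move=> t; exact/fI/fg.
exists f, g; split => //; apply/continuous_closedP => C clC.
have -> : g @^-1` C = f @` C.
  apply/seteqP; split=> [u Cu|_ [t Ct <-]] /=; last by rewrite gf.
  by exists (g u).
apply: compact_closed => //; apply: continuous_compact.
  exact: continuous_subspaceT.
exact: (subclosed_compact clC cT (@subsetT _ _)).
Qed.

(** * Light profinite spaces *)

(** For compact spaces this is an intrinsic form of being light profinite
    ([compact_light] and [light_countably_separated]) that passes visibly to
    closed subspaces. *)
Definition countably_separated (T : topologicalType) :=
  exists U : nat -> set T, (forall n, clopen (U n)) /\
    (forall x y, (forall n, U n x <-> U n y) -> x = y).

Lemma countably_separated_inj (T T' : topologicalType) (f : T -> T') :
  continuous f -> injective f -> countably_separated T' ->
  countably_separated T.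
Proof.
move=> cf fI [U [clU sU]]; exists (fun n => f @^-1` U n); split.
  by move=> n; exact: preimage_clopen.
by move=> x y xy; exact/fI/sU.
Qed.

Lemma countably_separated_zero_dimensional (T : topologicalType) :
  countably_separated T -> zero_dimensional T.
Proof.
move=> [U [clU sU]] x y /eqP xy.
have [n nxy] : exists n, ~ (U n x <-> U n y).
  by apply/existsNP => H; exact/xy/sU.
have [Ux|Ux] := pselect (U n x).
  by exists (U n); split=> // Uy; apply: nxy.
exists (~` U n); split => //.
  exact: (clopenC setT).
by move=> nUy; apply: nxy; split=> [/Ux|/nUy].
Qed.

Section SeqLimit.
Variables (F : nat -> finType) (t : forall n, F n.+1 -> F n).
Local Notation P := (prod_topology (fun n => discrete_topology (F n))).

Lemma continuous_proj n : continuous (fun a : P => a n).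
Proof. exact: (@proj_continuous nat (fun n => discrete_topology (F n))). Qed.

Lemma continuous_discrete (T : choiceType) (U : topologicalType)
    (f : discrete_topology T -> U) : continuous f.
Proof. by apply/continuousP => A _; exact: discrete_open. Qed.

Lemma compact_seq_limit : compact [set: set_type (seq_limit t)].
Proof.
apply: compact_subtype.
  rewrite (_ : setT = [set f : forall n, discrete_topology (F n) |
                        forall n, [set: discrete_topology (F n)] (f n)]).
    apply: (@tychonoff nat (fun n => discrete_topology (F n)) (fun=> setT)) => n.
    apply: finite_compact; exact: (@finite_finset (F n)).
  by apply/seteqP; split.
have -> : seq_limit t = \bigcap_n [set a : P | @t n (a n.+1) = a n].
  by apply/seteqP; split=> [a ta n _|a ta n]; [exact: ta|exact: ta n I].
apply: closed_bigI => n _.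
apply: (@closed_equalizer P (discrete_topology (F n))
   (fun a => @t n (a n.+1)) (fun a => a n)).
- exact: discrete_hausdorff.
- apply: (@continuous_compose P (discrete_topology (F n.+1)) (discrete_topology (F n))
    (fun a => a n.+1) (@t n)); first exact: continuous_proj.
  exact: continuous_discrete.
- exact: continuous_proj.
Qed.

(** The condition [a n = e] is clopen, and there are countably many pairs
    [(n, e)], enumerated through [unpickle]; numbers coding no pair get the empty
    set. *)
Lemma countably_separated_seq_limit :
  countably_separated (set_type (seq_limit t)).
Proof.
exists (fun m => if unpickle m is Some (existT n e)
  then (fun a => \val a n) @^-1` [set e : discrete_topology (F n)] else set0).
split=> [m|a b ab].
  case: unpickle => [[n e]|]; last exact: clopen0.
  apply: preimage_clopen.
    by split; [exact: discrete_open | exact: discrete_closed].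
  apply: (@continuous_compose _ P _ (fun a : set_type (seq_limit t) => \val a)
    (fun a => a n)); first exact: continuous_val.
  exact: continuous_proj.
apply/val_inj/functional_extensionality_dep => n.
have := ab (pickle (existT F n (\val a n))).
by rewrite pickleK /= => -[/(_ erefl)].
Qed.
End SeqLimit.

Lemma light_compact (T : topologicalType) :
  light_profinite T -> compact [set: T].
Proof.
move=> [F [t [f [g [cf cg fg gf]]]]].
have -> : [set: T] = g @` setT.
  by apply/seteqP; split=> // x _; exists (f x).
apply: continuous_compact; first exact: continuous_subspaceT.
exact: compact_seq_limit.
Qed.

Lemma light_countably_separated (T : topologicalType) :
  light_profinite T -> countably_separated T.
Proof.
move=> [F [t [f [g [cf cg fg gf]]]]].
apply: (countably_separated_inj cf); first exact: can_inj fg.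
exact: countably_separated_seq_limit.
Qed.

Lemma light_hausdorff (T : topologicalType) :
  light_profinite T -> hausdorff_space T.
Proof.
move/light_countably_separated/countably_separated_zero_dimensional.
exact: zero_dimensional_hausdorff.
Qed.

Section Pattern.
Variables (T : topologicalType) (U : nat -> set T).
Hypothesis clU : forall n, clopen (U n).

Definition pattern n (x : T) : {ffun 'I_n -> bool} :=
  [ffun i => `[< U (val i) x >]].

(** Only the patterns that occur are kept, so that a thread of the inverse system
    is a sequence of nonempty cylinders of [T]. *)
Definition patternT n :=
  {b : {ffun 'I_n -> bool} | `[< exists x, pattern n x = b >]}.

Lemma patternP n (x : T) : `[< exists y, pattern n y = pattern n x >].
Proof. by apply/asboolP; exists x. Qed.

Definition patternF n (x : T) : patternT n :=
  exist _ (pattern n x) (patternP n x).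

Definition forget n (b : {ffun 'I_n.+1 -> bool}) : {ffun 'I_n -> bool} :=
  [ffun i => b (widen_ord (leqnSn n) i)].

Lemma forget_pattern n x : forget (pattern n.+1 x) = pattern n x.
Proof. by apply/ffunP => i; rewrite !ffunE. Qed.

Lemma forgetP n (b : patternT n.+1) :
  `[< exists x, pattern n x = forget (val b) >].
Proof.
case: b => b /= /asboolP[x <-]; apply/asboolP; exists x.
by rewrite forget_pattern.
Qed.

Definition forgetF n (b : patternT n.+1) : patternT n :=
  exist _ (forget (val b)) (forgetP b).

Lemma pattern_clopen n (b : {ffun 'I_n -> bool}) :
  clopen (pattern n @^-1` [set b]).
Proof.
have -> : pattern n @^-1` [set b] =
    \big[setI/setT]_(i < n) (if b i then U i else ~` U i).
  rewrite -bigcap_seq.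
  apply/seteqP; split=> [x /= <- i _|x /= H].
    by rewrite ffunE; case: asboolP.
  apply/ffunP => i; rewrite ffunE; have := H i (mem_index_enum i).
  by case: (b i) => ?; [apply/asboolP|apply/asboolPn].
apply: big_ind => [||i _]; [exact: clopenT|exact: clopenI|].
by case: (b i); [|apply: (clopenC setT)].
Qed.

Hypothesis cT : compact [set: T].
Hypothesis sU : forall x y, (forall n, U n x <-> U n y) -> x = y.

Lemma pattern_limit x :
  (fun n => patternF n x) \in @seq_limit (fun n => patternT n) forgetF.
Proof. by apply/mem_set => n; apply/val_inj; exact: forget_pattern. Qed.

Definition to_limit x : set_type (@seq_limit (fun n => patternT n) forgetF) :=
  SigSub (pattern_limit x).

(** [T] maps bijectively onto the limit of its sets of patterns: injectively
    because the [U n] separate points, surjectively because the cylinders of a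
    thread are nested nonempty closed subsets of a compact space. *)
Lemma light_pattern : light_profinite T.
Proof.
exists (fun n => patternT n), forgetF.
apply: (@bijective_homeomorphic _ _ to_limit cT).
- apply: zero_dimensional_hausdorff; apply: countably_separated_zero_dimensional.
  exact: countably_separated_seq_limit.
- apply: continuous_into_subtype; apply: continuous_coord => n.
  apply/continuousP => B _.
  have -> : (fun x => patternF n x) @^-1` B =
      \bigcup_(b in B) (pattern n @^-1` [set \val b]).
    apply/seteqP; split=> [x Bx|x [b Bb /= e]]; first by exists (patternF n x).
    by rewrite /= (_ : patternF n x = b) //; exact: val_inj.
  by apply: bigcup_open => b _; case: (pattern_clopen (\val b)).
- move=> x y /(congr1 val) /= xy; apply: sU => n.
  have /ffunP/(_ ord_max) : pattern n.+1 x = pattern n.+1 y.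
    by have := congr1 (fun a => \val (a n.+1)) xy.
  rewrite !ffunE /= => e.
  by split=> /asboolP Un; apply/asboolP; [rewrite -e|rewrite e].
- move=> a.
  have [|||x Cx] := @compact_nested T
    (fun n => pattern n @^-1` [set \val (\val a n)]) cT.
  + by move=> n; case: (pattern_clopen (\val (\val a n))).
  + move=> n x /= e; rewrite -forget_pattern e.
    by rewrite -(set_valP a n).
  + by move=> n; have /asboolP[x e] := valP (\val a n); exists x.
  exists x; apply/val_inj/functional_extensionality_dep => n /=.
  by apply: val_inj; exact: Cx.
Qed.

End Pattern.

Lemma compact_light (T : topologicalType) :
  compact [set: T] -> countably_separated T -> light_profinite T.
Proof. by move=> cT [U [clU sU]]; exact: light_pattern clU cT sU. Qed.

Lemma light_closed_subtype (T : topologicalType) (A : set T) :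
  light_profinite T -> closed A -> light_profinite (set_type A).
Proof.
move=> lT clA; apply: compact_light.
  exact: compact_subtype (light_compact lT) clA.
apply: (countably_separated_inj (@continuous_val _ A)); first exact: val_inj.
exact: light_countably_separated.
Qed.

(** * A closed transversal of the isomorphism classes *)

Section Transversal.
Variable G : tgroupoid.
Local Notation L := (tlaws G).

Definition joined (x y : Obj G) := exists2 f : Mor G, src f = x & tgt f = y.

Lemma joined_refl x : joined x x.
Proof. by exists (idm x); [exact: (src_idm L) | exact: (tgt_idm L)]. Qed.

Lemma joined_sym x y : joined x y -> joined y x.
Proof.
by move=> [f <- <-]; exists (invm f); [exact: (src_inv L) | exact: (tgt_inv L)].
Qed.

Lemma joined_trans x y z : joined x y -> joined y z -> joined x z.
Proof.
move=> [f <- <-] [g gf <-].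
by exists (compm g f); [exact: (src_comp L) | exact: (tgt_comp L)].
Qed.

Definition saturation (A : set (Obj G)) := @tgt G @` (@src G @^-1` A).

Lemma saturationP A y : saturation A y <-> exists2 x, A x & joined x y.
Proof.
split=> [[f Af <-]|[x Ax [f fx fy]]]; first by exists (src f) => //; exists f.
by exists f => //=; rewrite /preimage /= fx.
Qed.

Hypotheses (lO : light_profinite (Obj G)) (lM : light_profinite (Mor G)).
Hypothesis tgt_open : open_map (@tgt G).

Lemma saturation_closed A : closed A -> closed (saturation A).
Proof.
move=> clA; apply: (compact_closed (light_hausdorff lO)).
apply: continuous_compact; first exact: continuous_subspaceT (@tgt_cts G).
apply: (subclosed_compact _ (light_compact lM) (@subsetT _ _)).
by apply: preimage_closed => // f _; exact: src_cts.
Qed.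

Lemma saturation_clopen A : clopen A -> clopen (saturation A).
Proof.
move=> [oA clA]; split; last exact: saturation_closed.
by apply: tgt_open; apply: open_comp => // f _; exact: src_cts.
Qed.

Section Sieve.
Variable U : nat -> set (Obj G).
Hypothesis clU : forall n, clopen (U n).
Hypothesis sU : forall x y, (forall n, U n x <-> U n y) -> x = y.

(** The second factor keeps [U m], and keeps entirely the classes without a point
    in [sieve m] and [U m]. *)
Fixpoint sieve n : set (Obj G) :=
  if n is m.+1 then sieve m `&` (U m `|` ~` saturation (sieve m `&` U m))
  else setT.

Lemma sieve_clopen n : clopen (sieve n).
Proof.
elim: n => [|n IH]; first exact: clopenT.
apply: clopenI => //; apply: clopenU => //.
by apply: (clopenC setT); apply: saturation_clopen; exact: clopenI.
Qed.

Lemma sieve_meets n x : exists2 y, sieve n y & joined x y.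
Proof.
elim: n => [|n [y sy xy]]; first by exists x => //; exact: joined_refl.
have [H|H] := pselect (saturation (sieve n `&` U n) y).
  have /saturationP[z [sz Uz] zy] := H.
  exists z; first by split=> //; left.
  exact: joined_trans xy (joined_sym zy).
by exists y => //; split=> //; right.
Qed.

Definition transversal := \bigcap_n sieve n.

Lemma transversal_closed : closed transversal.
Proof. by apply: closed_bigI => n _; case: (sieve_clopen n). Qed.

(** Isomorphism classes are closed, so the traces of the stages on one class are
    nested nonempty closed sets. *)
Lemma transversal_meets x : exists2 y, transversal y & joined x y.
Proof.
pose C n := sieve n `&` saturation [set x].
have [|||y Cy] := @compact_nested _ C (light_compact lO).
- move=> n; apply: closedI; first by case: (sieve_clopen n).
  apply: saturation_closed; apply: compact_closed (light_hausdorff lO) _.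
  exact: compact_set1.
- by move=> n y [[sy _] ?].
- move=> n; have [y sy xy] := sieve_meets n x.
  by exists y; split=> //; apply/saturationP; exists x.
exists y; first by move=> n _; case: (Cy n I).
by have [_ /saturationP[_ -> ]] := Cy 0%N I.
Qed.

(** As soon as [x] witnesses that its class meets [sieve n] in [U n], step [n]
    discards the rest of the class. *)
Lemma transversal_sub x y n : transversal x -> transversal y -> joined x y ->
  U n x -> U n y.
Proof.
move=> tx ty xy Ux; have [_ [//|]] := ty n.+1 I.
by case; apply/saturationP; exists x => //; split=> //; exact: tx.
Qed.

Lemma transversal_uniq x y : transversal x -> transversal y -> joined x y ->
  x = y.
Proof.
move=> tx ty xy; apply: sU => n.
by split; apply: transversal_sub => //; exact: joined_sym.
Qed.

End Sieve.

Lemma closed_transversal : exists E : set (Obj G), [/\ closed E,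
  forall x, exists2 y, E y & joined x y
  & forall x y, E x -> E y -> joined x y -> x = y].
Proof.
have [U [clU sU]] := light_countably_separated lO.
exists (transversal U); split.
- exact: transversal_closed.
- exact: transversal_meets.
- exact: transversal_uniq.
Qed.

End Transversal.

(** * Full subgroupoids *)

Section Full.
Variables (G : tgroupoid) (E : set (Obj G)).
Local Notation L := (tlaws G).

Definition full_mor := [set f : Mor G | E (src f) /\ E (tgt f)].
Local Notation O := (set_type E).
Local Notation M := (set_type full_mor).

Lemma full_src_mem (f : M) : src (\val f) \in E.
Proof. by apply/mem_set; case: (set_valP f). Qed.

Lemma full_tgt_mem (f : M) : tgt (\val f) \in E.
Proof. by apply/mem_set; case: (set_valP f). Qed.

Lemma full_id_mem (x : O) : idm (\val x) \in full_mor.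
Proof.
apply/mem_set; rewrite /full_mor /= (src_idm L) (tgt_idm L).
by split; exact: set_valP.
Qed.

Lemma full_inv_mem (f : M) : invm (\val f) \in full_mor.
Proof.
apply/mem_set; rewrite /full_mor /= (src_inv L) (tgt_inv L).
by case: (set_valP f).
Qed.

Lemma full_comp_mem (g f : M) : src (\val g) = tgt (\val f) ->
  compm (\val g) (\val f) \in full_mor.
Proof.
move=> gf; apply/mem_set; rewrite /full_mor /= (src_comp L) // (tgt_comp L) //.
by case: (set_valP f); case: (set_valP g).
Qed.

Definition full_src (f : M) : O := SigSub (full_src_mem f).
Definition full_tgt (f : M) : O := SigSub (full_tgt_mem f).
Definition full_id (x : O) : M := SigSub (full_id_mem x).
Definition full_inv (f : M) : M := SigSub (full_inv_mem f).

(** On pairs that are not composable in [G] the composite in [G] need not lie in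
    [full_mor], so a default value is used there. *)
Definition full_comp (g f : M) : M :=
  match pselect (src (\val g) = tgt (\val f)) with
  | left gf => SigSub (full_comp_mem gf)
  | right _ => f
  end.

Lemma full_compE (g f : M) : src (\val g) = tgt (\val f) ->
  \val (full_comp g f) = compm (\val g) (\val f).
Proof. by rewrite /full_comp; case: pselect. Qed.

Lemma full_laws : groupoid_laws full_src full_tgt full_id full_inv full_comp.
Proof.
have V (g f : M) : full_src g = full_tgt f -> src (\val g) = tgt (\val f).
  by move/(congr1 val).
have S g f : full_src g = full_tgt f -> full_src (full_comp g f) = full_src f.
  by move/V => gf; apply: val_inj; rewrite /= full_compE // (src_comp L).
have T g f : full_src g = full_tgt f -> full_tgt (full_comp g f) = full_tgt g.
  by move/V => gf; apply: val_inj; rewrite /= full_compE // (tgt_comp L).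
split=> //.
- by move=> x; apply: val_inj; exact: (src_idm L).
- by move=> x; apply: val_inj; exact: (tgt_idm L).
- by move=> f; apply: val_inj; exact: (src_inv L).
- by move=> f; apply: val_inj; exact: (tgt_inv L).
- move=> h g f hg gf; apply: val_inj.
  rewrite full_compE; last by apply: V; rewrite T.
  rewrite full_compE; last exact: V.
  rewrite full_compE; last by apply: V; rewrite S.
  rewrite full_compE; last exact: V.
  by rewrite (Defs.compA L) //; exact: V.
- move=> f; apply: val_inj; rewrite full_compE; last exact: (src_idm L).
  exact: (comp_idl L).
- move=> f; apply: val_inj; rewrite full_compE; last exact/esym/(tgt_idm L).
  exact: (comp_idr L).
- move=> f; apply: val_inj; rewrite full_compE; last exact: (src_inv L).
  exact: (comp_invl L).
- move=> f; apply: val_inj; rewrite full_compE; last exact/esym/(tgt_inv L).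
  exact: (comp_invr L).
Qed.

Lemma full_src_cts : continuous full_src.
Proof.
apply: continuous_into_subtype.
exact: continuous_compose (@continuous_val _ _) (@src_cts G).
Qed.

Lemma full_tgt_cts : continuous full_tgt.
Proof.
apply: continuous_into_subtype.
exact: continuous_compose (@continuous_val _ _) (@tgt_cts G).
Qed.

Lemma full_id_cts : continuous full_id.
Proof.
apply: continuous_into_subtype.
exact: continuous_compose (@continuous_val _ _) (@idm_cts G).
Qed.

Lemma full_inv_cts : continuous full_inv.
Proof.
apply: continuous_into_subtype.
exact: continuous_compose (@continuous_val _ _) (@invm_cts G).
Qed.

Lemma full_comp_cts : {within [set gf : M * M | full_src gf.1 = full_tgt gf.2],
  continuous (fun gf => full_comp gf.1 gf.2)}.
Proof.
(* The composition of [G] restricted to composable pairs is continuous on the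
   subtype [B]; composable pairs of the subgroupoid map continuously to [B]. *)
apply/subspace_sigL_continuousP; apply: continuous_into_subtype.
set A := [set gf : M * M | _].
pose B := [set gf : Mor G * Mor G | src gf.1 = tgt gf.2].
have AB (a : set_type A) : (\val (\val a).1, \val (\val a).2) \in B.
  by apply/mem_set; exact: (congr1 val (set_valP a)).
pose k (a : set_type A) : set_type B := SigSub (AB a).
have -> : (fun t => \val (sigL A (fun gf => full_comp gf.1 gf.2) t)) =
    sigL B (fun gf => compm gf.1 gf.2) \o k.
  apply/funext => a; rewrite /sigL /=.
  by apply: full_compE; exact: (congr1 val (set_valP a)).
apply: continuous_compose; last exact/subspace_sigL_continuousP/(@compm_cts G).
apply: continuous_into_subtype; apply: continuous_pair.
  apply: continuous_compose (@continuous_val _ _).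
  apply: continuous_compose; first exact: continuous_val.
  by move=> ?; exact: cvg_fst.
apply: continuous_compose (@continuous_val _ _).
apply: continuous_compose; first exact: continuous_val.
by move=> ?; exact: cvg_snd.
Qed.

Definition full : tgroupoid := TGroupoid full_laws full_src_cts full_tgt_cts
  full_id_cts full_inv_cts full_comp_cts.

Lemma full_incl_comp (g f : Mor full) : src g = tgt f ->
  \val (compm g f) = compm (\val g) (\val f).
Proof. by move/(congr1 val); exact: full_compE. Qed.

Definition full_incl : tfunctor full G :=
  @TFunctor full G (fun x => \val x) (fun f => \val f)
    (@continuous_val _ _) (@continuous_val _ _)
    (fun _ => erefl) (fun _ => erefl) (fun _ => erefl) full_incl_comp.

Hypothesis lO : light_profinite (Obj G).
Hypothesis lM : light_profinite (Mor G).
Hypothesis clE : closed E.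

Lemma full_light : light_profinite (Obj full) /\ light_profinite (Mor full).
Proof.
split; first exact: light_closed_subtype.
apply: light_closed_subtype => //.
by apply: closedI; apply: preimage_closed => // f _;
  [exact: src_cts|exact: tgt_cts].
Qed.
End Full.

(** * Nerves of full embeddings *)

Section FullEmbedding.
Variables (X Y : groupoid) (P : gfunctor X Y).

Record full_embedding : Prop := FullEmbedding {
  emb_obj : injective (gfobj P);
  emb_mor : injective (gfmor P);
  emb_full : forall a b g, gsrc g = gfobj P a -> gtgt g = gfobj P b ->
    exists f, gfmor P f = g }.

Hypothesis eP : full_embedding.

Lemma nmap_inj n : injective (@nmap X Y P n).
Proof.
move=> x y xy; apply: nsimp_eq => [i|i j ij].
  by apply: (emb_obj eP); have := congr1 (fun z => vert z i) xy.
by apply: (emb_mor eP); have := congr1 (fun z => edge z ij) xy.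
Qed.

(** A full embedding identifies the nerve of [X] with the full simplicial subset of
    the nerve of [Y] spanned by the vertices in the image. *)
Lemma nmap_lift n (y : nerve Y n) :
  (forall i, exists a, gfobj P a = vert y i) -> exists x, nmap P x = y.
Proof.
move=> vy; pose v i := sval (cid (vy i)).
have vE i : gfobj P (v i) = vert y i := svalP (cid (vy i)).
have ey (i j : 'I_n.+1) (ij : (i <= j)%N) : exists f, gfmor P f = edge y ij.
  by apply: (emb_full eP (a := v i) (b := v j)); rewrite ?edge_src ?edge_tgt vE.
pose e (i j : 'I_n.+1) (ij : (i <= j)%N) := sval (cid (ey i j ij)).
have eE i j ij : gfmor P (e i j ij) = edge y ij := svalP (cid (ey i j ij)).
have es i j ij : gsrc (e i j ij) = v i.
  by apply: (emb_obj eP); rewrite -gfsrc eE edge_src vE.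
have et i j ij : gtgt (e i j ij) = v j.
  by apply: (emb_obj eP); rewrite -gftgt eE edge_tgt vE.
have ei i ii : e i i ii = gid (v i).
  by apply: (emb_mor eP); rewrite gfid eE edge_id vE.
have ec (i j k : 'I_n.+1) (ij : (i <= j)%N) (jk : (j <= k)%N) (ik : (i <= k)%N) :
    e i k ik = gcomp (e j k jk) (e i j ij).
  apply: (emb_mor eP); rewrite gfcomp ?es ?et // !eE; exact: edge_comp.
exists (NSimp es et ei ec).
by apply: nsimp_eq => [i|i j ij] /=; [exact: vE|exact: eE].
Qed.

(** Two faces of a simplex that come from [X] put all its vertices in the image,
    since the [k]-th face misses only the vertex [k]. *)
Lemma vert_face n (y : nerve Y n.+1) (k : 'I_n.+2) (x : nerve X n)
    (i : 'I_n.+2) :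
  sact (face k) y = nmap P x -> i != k -> exists a, gfobj P a = vert y i.
Proof.
move=> e ik; have [j -> _] : {j | i = lift k j & unlift k i = Some j}.
  by apply: unlift_some; rewrite eq_sym.
by exists (vert x j); have /= -> := congr1 (fun z => vert z j) e.
Qed.

End FullEmbedding.

Lemma nerve0_eq (Y : groupoid) (a b : nerve Y 0) :
  vert a ord0 = vert b ord0 -> a = b.
Proof.
move=> ab; apply: nsimp_eq => [i|i j ij]; first by rewrite ord1.
have ji : i = j by rewrite !(ord1 i) !(ord1 j).
by subst j; rewrite !edge_id (ord1 i) ab.
Qed.

Lemma gid_comp (Y : groupoid) (a : gObj Y) : gid a = gcomp (gid a) (gid a).
Proof.
by have := comp_idr (glaws Y) (gid a); rewrite (src_idm (glaws Y)) => ->.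
Qed.

Definition point_simplex (Y : groupoid) (a : gObj Y) : nerve Y 0 :=
  @NSimp Y 0 (fun=> a) (fun _ _ _ => gid a)
    (fun _ _ _ => src_idm (glaws Y) a) (fun _ _ _ => tgt_idm (glaws Y) a)
    (fun _ _ => erefl) (fun _ _ _ _ _ _ => gid_comp a).

Section Iso.
Variables (Y : groupoid) (f : gMor Y).
Local Notation L := (glaws Y).

(** The 1-simplex of [f] is presented by spokes with common source [gsrc f], one
    to each vertex: its edge from [i] to [j] is the [j]-th spoke composed with the
    inverse of the [i]-th, which makes [comp_chain] the functoriality of edges. *)
Definition iso_spoke (i : 'I_2) := if i == ord0 then gid (gsrc f) else f.

Lemma iso_spoke_src i : gsrc (iso_spoke i) = gsrc f.
Proof. by rewrite /iso_spoke; case: ifP => // _; rewrite (src_idm L). Qed.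

Let fe (i j : 'I_2) (_ : (i <= j)%N) := gcomp (iso_spoke j) (ginv (iso_spoke i)).

Let cond i j : gsrc (iso_spoke j) = gtgt (ginv (iso_spoke i)).
Proof. by rewrite (tgt_inv L) !iso_spoke_src. Qed.

Let fe_src (i j : 'I_2) (ij : (i <= j)%N) : gsrc (@fe i j ij) = gtgt (iso_spoke i).
Proof. by rewrite (src_comp L) // (src_inv L). Qed.

Let fe_tgt (i j : 'I_2) (ij : (i <= j)%N) : gtgt (@fe i j ij) = gtgt (iso_spoke j).
Proof. by rewrite (tgt_comp L). Qed.

Let fe_id (i : 'I_2) (ii : (i <= i)%N) : @fe i i ii = gid (gtgt (iso_spoke i)).
Proof. by rewrite /fe (comp_invr L). Qed.

Let fe_comp (i j l : 'I_2) (ij : (i <= j)%N) (jl : (j <= l)%N) (il : (i <= l)%N) :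
  @fe i l il = gcomp (@fe j l jl) (@fe i j ij).
Proof. by rewrite /fe comp_chain ?iso_spoke_src. Qed.

Definition iso_simplex : nerve Y 1 :=
  @NSimp Y 1 (fun i => gtgt (iso_spoke i)) (@fe) fe_src fe_tgt fe_id fe_comp.

Lemma connected0_iso (a b : nerve Y 0) :
  gsrc f = vert a ord0 -> gtgt f = vert b ord0 -> Defs.connected0 a b.
Proof.
move=> fa fb; exists iso_simplex; split; apply: nerve0_eq => /=.
  by rewrite /iso_spoke /= (tgt_idm L) fa.
by rewrite /iso_spoke /= fb.
Qed.
End Iso.

Section Degeneracy.
Variables (K : sset) (n : nat).

(** The degeneracy [s_(n+1)], which repeats the last vertex. *)
Definition last_deg_fun (i : 'I_n.+3) : 'I_n.+2 := inord (minn i n.+1).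

Lemma last_degE i : last_deg_fun i = minn i n.+1 :> nat.
Proof. by rewrite inordK // ltnS geq_minr. Qed.

Lemma last_deg_homo : {homo last_deg_fun : i j / (i <= j)%N}.
Proof.
move=> i j ij; rewrite !last_degE leq_min geq_minr andbT.
exact: leq_trans (geq_minl _ _) ij.
Qed.

Definition last_deg : mono n.+2 n.+1 := Mono last_deg_homo.

Lemma last_deg_face (k : 'I_n.+3) : (n < k)%N ->
  mono_comp last_deg (face k) = mono_id n.+1.
Proof.
move=> nk; apply: mono_eq => i; apply: ord_inj; rewrite [LHS]last_degE /= /bump.
have := ltn_ord i; rewrite ltnS => iN.
case: (leqP k i) => [ki|ik]; last by rewrite add0n; apply/minn_idPl.
have -> : nat_of_ord i = n.+1 by apply/eqP; rewrite eqn_leq iN (leq_trans nk ki).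
by apply/minn_idPr; rewrite add1n.
Qed.

Lemma sact_const m l (f : mono l m) (x : K 0) :
  sact f (const_simp x m) = const_simp x l.
Proof. by rewrite /const_simp -sact_comp; congr sact; exact: mono_eq. Qed.

(** The degenerate simplex [s_(n+1) b] has last two faces [b]; for [i <= n] its
    [i]-th face factors through the [i]-th face of [b], which is constant. *)
Lemma homotopic_refl (x : K 0) (b : K n.+1) : spherical x b -> homotopic x b b.
Proof.
move=> sb; exists (sact last_deg b); split.
- by rewrite -sact_comp last_deg_face ?sact_id // inordK.
- by rewrite -sact_comp last_deg_face ?sact_id.
move=> i iN; rewrite -sact_comp.
have iN2 : (i < n.+2)%N by rewrite ltnW.
have [j|f' ->] := @face_factor n n.+1 (mono_comp last_deg (face i)) (Ordinal iN2).
  rewrite -val_eqE [X in X != _]last_degE /=.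
  case: (leqP (bump i j) n.+1) => _; first by rewrite eq_sym neq_bump.
  by rewrite gtn_eqF.
by rewrite sact_comp sb sact_const.
Qed.

End Degeneracy.

(** * From full embeddings to equivalences *)

Lemma locally_self (S : profinite)
    (Q : forall T : profinite, continuousType T S -> Prop) :
  Q S [the continuousType S S of idfun] -> locally Q.
Proof.
move=> QS; exists unit, (fun=> S), (fun=> [the continuousType S S of idfun]).
by split=> // s; exists tt, s.
Qed.

Section Equivalence.
Variables (X G : tgroupoid) (p : tfunctor X G).
Hypothesis emb : forall S, full_embedding (points_map p S).
Hypothesis surj : forall (S : profinite) (y : gObj (points G S)),
  locally (fun T (u : continuousType T S) =>
    exists (a : gObj (points X T)) (f : gMor (points G T)),
      gsrc f = gfobj (points_map p T) a /\ gtgt f = gfobj (points_res G u) y).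

Lemma embedding_pi0 : pi0_iso (realization_map p).
Proof.
split=> [S a b [w [wa wb]]|S b].
  apply: locally_self; rewrite !res_id.
  have [i|w' ew] := @nmap_lift _ _ _ (emb S) 1 w.
    have [->|i0] := eqVneq i ord0.
      by apply: (vert_face (k := ord_max) (x := a)).
    exact: (vert_face (k := ord0) (x := b)).
  exists w'; split; apply: (nmap_inj (emb S)); rewrite nmap_nat ew.
    exact: wa.
  exact: wb.
have [I [U [u [cu H]]]] := surj (vert b ord0).
exists I, U, u; split=> // i.
have [a [f [fa fb]]] := H i.
exists (point_simplex a).
by apply: (@connected0_iso (points G (U i)) f); [exact: fa|exact: fb].
Qed.

(** Both halves hold without passing to a cover. A homotopy between images of
    simplices of [X] has two faces from [X], so it lifts. A spherical simplex has
    constant faces, so it lifts too, and its image is homotopic to it by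
    reflexivity. *)
Lemma embedding_pi n : pi_iso (realization_map p) n.
Proof.
move=> S x; split=> [a b sa sb [w [wa wb wx]]|b sb].
  apply: locally_self; rewrite !res_id.
  have [i|w' ew] := @nmap_lift _ _ _ (emb S) n.+2 w.
    have [->|i0] := eqVneq i ord_max.
      apply: (vert_face (k := inord n.+1) (x := a)) => //.
      by rewrite -val_eqE /= inordK // gtn_eqF.
    exact: (vert_face (k := ord_max) (x := b)).
  exists w'; split=> [||i iN]; apply: (nmap_inj (emb S)); rewrite nmap_nat ew.
  - exact: wa.
  - exact: wb.
  - by rewrite /const_simp nmap_nat; exact: wx.
apply: locally_self; rewrite !res_id.
have [i|a ea] := @nmap_lift _ _ _ (emb S) n.+1 b.
  (* Any face opposite to a vertex other than [i] contains [i]. *)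
  pose k : 'I_n.+2 := if i == ord0 then ord_max else ord0.
  apply: (vert_face (k := k) (x := const_simp x n)).
    by rewrite /const_simp nmap_nat; exact: sb.
  by rewrite /k; case: (eqVneq i ord0) => [->|].
exists a; split=> [i|].
  apply: (nmap_inj (emb S)); rewrite nmap_nat ea /const_simp nmap_nat.
  exact: sb.
have -> : realization_map p S n.+1 a = b by [].
exact: homotopic_refl.
Qed.

Lemma embedding_pyk_equivalence : pyk_equivalence (realization_map p).
Proof. by split; [exact: embedding_pi0|exact: embedding_pi]. Qed.

End Equivalence.

(** * The cover by morphisms into the transversal *)

Lemma jointly_injective_hausdorff (T U V : topologicalType)
    (f : T -> U) (g : T -> V) : continuous f -> continuous g ->
  (forall x y, f x = f y -> g x = g y -> x = y) ->
  hausdorff_space U -> hausdorff_space V -> hausdorff_space T.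
Proof.
move=> cf cg fgI hU hV x y cxy.
apply: fgI; [apply: hU | apply: hV] => A B nA nB.
  have nfA : nbhs x (f @^-1` A) by exact: cf.
  have nfB : nbhs y (f @^-1` B) by exact: cf.
  by have [z [Az Bz]] := cxy _ _ nfA nfB; exists (f z).
have nfA : nbhs x (g @^-1` A) by exact: cg.
have nfB : nbhs y (g @^-1` B) by exact: cg.
by have [z [Az Bz]] := cxy _ _ nfA nfB; exists (g z).
Qed.

Lemma connected_image_point (T U : topologicalType) (f : T -> U)
    (C : set T) x y :
  continuous f -> totally_disconnected [set: U] -> connected C ->
  C x -> C y -> f y = f x.
Proof.
move=> cf td cC Cx Cy.
have : connected_component [set: U] (f x) (f y).
  exists (f @` C); last exact: imageP.
  split; [exact: imageP | exact: subsetT |].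
  by apply: connected_continuous_connected => //; exact: continuous_subspaceT.
by rewrite td // => ->.
Qed.

Lemma jointly_injective_totally_disconnected (T U V : topologicalType)
    (f : T -> U) (g : T -> V) : continuous f -> continuous g ->
  (forall x y, f x = f y -> g x = g y -> x = y) ->
  totally_disconnected [set: U] -> totally_disconnected [set: V] ->
  totally_disconnected [set: T].
Proof.
move=> cf cg fgI tU tV x _; apply/seteqP; split=> [y [C [Cx _ cC] Cy]|_ ->].
  apply: fgI; first exact: connected_image_point cf tU cC _ _.
  exact: connected_image_point cg tV cC _ _.
exact: connected_component_refl.
Qed.

Section Cover.
Variables (G : tgroupoid) (E : set (Obj G)).
Local Notation L := (tlaws G).
Local Notation X := (full E).
Hypothesis lO : light_profinite (Obj G).
Hypothesis lM : light_profinite (Mor G).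

Lemma points_full_embedding (S : profinite) :
  full_embedding (points_map (full_incl E) S).
Proof.
split.
- move=> a b ab; apply/continuousEP => s; apply: val_inj.
  by have /continuousEP/(_ s) := ab.
- move=> a b ab; apply/continuousEP => s; apply: val_inj.
  by have /continuousEP/(_ s) := ab.
move=> a b g ga gb.
have ga' s : src (g s) = \val (a s) by have /continuousEP/(_ s) := ga.
have gb' s : tgt (g s) = \val (b s) by have /continuousEP/(_ s) := gb.
have gE s : g s \in full_mor E.
  by apply/mem_set; split; rewrite ?ga' ?gb'; exact: set_valP.
have cg : continuous (fun s => SigSub (gE s) : Mor X).
  apply: continuous_into_subtype; exact: cts_fun.
by exists (cts cg); apply/continuousEP => s.
Qed.

Hypothesis clE : closed E.
Hypothesis meetsE : forall x, exists2 y, E y & joined x y.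

Section Points.
Variables (S : profinite) (x : continuousType S (Obj G)).

(** The pairs [(s, f)] where [f] is a morphism from [x s] to a point of [E]. *)
Definition into_E :=
  [set sf : S * Mor G | src sf.2 = x sf.1] `&` [set sf | E (tgt sf.2)].

Local Notation T := (set_type into_E).

Lemma into_E_fst_cts : continuous (fun t : T => (\val t).1).
Proof.
apply: (continuous_compose (@continuous_val _ into_E)).
by move=> ?; exact: cvg_fst.
Qed.

Lemma into_E_snd_cts : continuous (fun t : T => (\val t).2).
Proof.
apply: (continuous_compose (@continuous_val _ into_E)).
by move=> ?; exact: cvg_snd.
Qed.

Lemma into_E_inj (s t : T) :
  (\val s).1 = (\val t).1 -> (\val s).2 = (\val t).2 -> s = t.
Proof.
move=> e1 e2; apply: val_inj.
by move: e1 e2; case: (\val s) (\val t) => [? ?] [? ?] /= -> ->.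
Qed.

Lemma into_E_compact : compact [set: T].
Proof.
apply: compact_subtype.
  rewrite -setXTT; apply: compact_setX; first exact: pspace_compact.
  exact: light_compact.
apply: closedI.
  apply: closed_equalizer; first exact: light_hausdorff.
    by apply: continuous_compose (@src_cts G) => ?; exact: cvg_snd.
  apply: continuous_compose; last exact: cts_fun.
  by move=> ?; exact: cvg_fst.
apply: (@preimage_closed _ _ (fun sf : S * Mor G => tgt sf.2)) => // sf _.
apply: (@continuous_compose _ _ _ _ _ _ (@tgt_cts G)).
by move=> ?; exact: cvg_snd.
Qed.

Lemma into_E_hausdorff : hausdorff_space T.
Proof.
apply: (jointly_injective_hausdorff into_E_fst_cts into_E_snd_cts into_E_inj).
  exact: pspace_hausdorff.
exact: light_hausdorff.
Qed.

Lemma into_E_td : totally_disconnected [set: T].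
Proof.
apply: (jointly_injective_totally_disconnected into_E_fst_cts into_E_snd_cts
  into_E_inj).
  exact: pspace_tdisc.
apply: zero_dimension_totally_disconnected.
apply: countably_separated_zero_dimensional.
exact: light_countably_separated.
Qed.

Definition into_E_profinite :=
  Profinite into_E_compact into_E_hausdorff into_E_td.

Definition into_E_proj : continuousType into_E_profinite S :=
  @cts into_E_profinite S _ into_E_fst_cts.
End Points.

(** The cover is [into_E y]; it surjects onto [S] because [E] meets every class.
    Over [(s, f)] the object of [X] is [tgt f], and the inverse of [f] joins it to
    [y s]. *)
Lemma points_surjective (S : profinite) (y : gObj (points G S)) :
  locally (fun T (u : continuousType T S) =>
    exists (a : gObj (points X T)) (f : gMor (points G T)),
      gsrc f = gfobj (points_map (full_incl E) T) a /\
      gtgt f = gfobj (points_res G u) y).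
Proof.
exists unit, (fun=> into_E_profinite y), (fun=> into_E_proj y); split.
  move=> s; have [z Ez [f fs fz]] := meetsE (y s).
  have m : (s, f) \in into_E y by apply/mem_set; split=> //=; rewrite fz.
  by exists tt, (SigSub m).
move=> _.
have tE (t : into_E_profinite y) : tgt (\val t).2 \in E.
  by apply/mem_set; case: (set_valP t).
have ca : continuous (fun t : into_E_profinite y => SigSub (tE t) : Obj X).
  apply: continuous_into_subtype.
  exact: continuous_compose (@into_E_snd_cts _ _) (@tgt_cts G).
have cf : continuous (fun t : into_E_profinite y => invm (\val t).2).
  exact: continuous_compose (@into_E_snd_cts _ _) (@invm_cts G).
exists (cts ca), (cts cf); split; apply/continuousEP => t.
  exact: (src_inv L).
by rewrite [LHS](tgt_inv L); case: (set_valP t).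
Qed.

End Cover.

Theorem lemmaE (G : tgroupoid)
    (objG_light : light_profinite (Obj G)) (morG_light : light_profinite (Mor G))
    (src_open : open_map (@src G)) (tgt_open : open_map (@tgt G)) :
  exists (X : tgroupoid) (p : tfunctor X G),
    [/\ light_profinite (Obj X) /\ light_profinite (Mor X),
        pyk_equivalence (realization_map p)
      & forall x y : Obj X, x <> y ->
          ~ exists f : Mor X, src f = x /\ tgt f = y].
Proof.
have [E [clE meetsE uniqE]] := closed_transversal objG_light morG_light tgt_open.
exists (full E), (full_incl E); split.
- exact: full_light.
- apply: embedding_pyk_equivalence; first exact: points_full_embedding.
  exact: points_surjective.
move=> x y xy [f [fx fy]]; apply: xy; apply: val_inj.
apply: uniqE; [exact: set_valP|exact: set_valP|].
by exists (\val f); [rewrite -fx|rewrite -fy].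
Qed.
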